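(* Assume Martin's Axiom. Then there exist separable metrizable spaces $X$, $Y$ and a $G_\delta$-measurable map $f:X\to Y$ that is not piecewise continuous.
   Context: Maps need not be continuous. A map $f:X\to Y$ between topological spaces is $G_\delta$-measurable if for every open set $U\subset Y$ the preimage $f^{-1}(U)$ is of type $G_\delta$ in $X$. It is piecewise continuous if $X$ has a countable closed cover $\mathcal C$ such that the restriction $f|C$ is continuous for every $C\in\mathcal C$. *)

(* Defs.v *)
From HB Require Import structures.
From mathcomp Require Import all_boot all_order all_algebra.
From mathcomp Require Import all_classical all_reals all_analysis.
From mathcomp Require Import borel_hierarchy.

Set Implicit Arguments.
Unset Strict Implicit.
Unset Printing Implicit Defensive.

Import Order.TTheory GRing.Theory Num.Theory.

Local Open Scope classical_set_scope.

Section MartinAxiom.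
Local Open Scope order_scope.
Local Open Scope card_scope.

Definition compatible {d} {P : porderType d} (p q : P) : Prop :=
  exists r : P, r <= p /\ r <= q.

Definition strong_antichain {d} {P : porderType d} (A : set P) : Prop :=
  forall p q : P, A p -> A q -> p <> q -> ~ compatible p q.

Definition ccc {d} (P : porderType d) : Prop :=
  forall A : set P, strong_antichain A -> countable A.

Definition order_dense {d} {P : porderType d} (D : set P) : Prop :=
  forall p : P, exists2 q : P, D q & q <= p.

Definition order_filter {d} {P : porderType d} (G : set P) : Prop :=
  [/\ G !=set0,
      (forall p q : P, G p -> p <= q -> G q) &
      (forall p q : P, G p -> G q -> exists r : P, [/\ G r, r <= p & r <= q])].

(* The cardinality of the continuum is that of the power set of [nat]. *)
Definition less_than_continuum {T : Type} (A : set T) : Prop :=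
  A #<= [set: set nat] /\ ~ ([set: set nat] #<= A).

(* CH is not excluded: under CH this holds outright. *)
Definition MartinAxiom : Prop :=
  forall (d : Order.disp_t) (P : porderType d) (DD : set (set P)),
    inhabited P -> ccc P ->
    less_than_continuum DD -> (forall D, DD D -> order_dense D) ->
    exists G : set P,
      order_filter G /\ (forall D, DD D -> G `&` D !=set0).

End MartinAxiom.

Section Spaces.
Local Open Scope ring_scope.

Definition is_metric {R : realType} {T : Type} (dist : T -> T -> R) : Prop :=
  [/\ (forall x y, 0 <= dist x y),
      (forall x y, dist x y = 0 <-> x = y),
      (forall x y, dist x y = dist y x) &
      (forall x y z, dist x z <= dist x y + dist y z)].

Definition metrizable (R : realType) (T : topologicalType) : Prop :=
  exists dist : T -> T -> R,
    is_metric dist /\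
    (forall U : set T, open U <->
       (forall x, U x ->
          exists2 e : R, 0 < e & [set y | dist x y < e] `<=` U)).

Definition separable (T : topologicalType) : Prop :=
  exists2 A : set T, countable A & dense A.

Definition Gdelta_measurable_map {X Y : topologicalType} (f : X -> Y) : Prop :=
  forall U : set Y, open U -> Gdelta (f @^-1` U).

Definition piecewise_continuous {X Y : topologicalType} (f : X -> Y) : Prop :=
  exists CC : set (set X),
    [/\ countable CC,
        (forall C, CC C -> closed C),
        \bigcup_(C in CC) C = [set: X] &
        (forall C, CC C -> {within C, continuous f})].

End Spaces.

(* Main.v *)
Require Import Defs.
From HB Require Import structures.
From mathcomp Require Import all_boot all_order all_algebra.
From mathcomp Require Import all_classical all_reals all_analysis.
From mathcomp Require Import borel_hierarchy.

(** Let Z be the set of sequences of naturals, with two topologies: the fine one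
   is that of the Baire space, and in the coarse one the value n of a coordinate
   converges to the value 0 as n grows. Every fine cylinder is coarsely closed,
   so fine open sets are coarse F_sigma sets. Under Martin's axiom there is a
   Luzin-type set S: it meets every cylinder outside of any given meager set,
   while its trace on each meager set is relatively F_sigma in the coarse
   topology. It is built by recursion of length continuum. At stage a, with fewer
   than continuum many points chosen, a sigma-centered forcing gives a coarse
   F_sigma meager set H_a whose trace on these points is that of the a-th meager
   set, and Cohen forcing gives a new point avoiding all H_b and all the meager
   sets met so far. The map is the identity of S from the coarse to the fine
   topology. The complement of a fine open set is its fine interior together with
   a nowhere dense set, so it is coarsely F_sigma. By Baire category, one piece
   of a countable coarsely closed cover contains the trace of a cylinder, on
   which the two topologies differ. *)

Set Implicit Arguments.
Unset Strict Implicit.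
Unset Printing Implicit Defensive.

Local Open Scope classical_set_scope.
Local Open Scope card_scope.

(** * Injections and the cofinality of the continuum *)

Section Cardinality.

Lemma card_le_of_inj (T U : Type) (A : set T) (B : set U) (f : T -> U) :
  (forall x, A x -> B (f x)) ->
  (forall x y, A x -> A y -> f x = f y -> x = y) -> A #<= B.
Proof.
move=> AB fI; rewrite -(card_le_eql (inj_card_eq (f := f) (A := A) _)).
  by apply: subset_card_le => _ [x Ax <-]; exact: AB.
by move=> x y; rewrite !inE => Ax Ay; exact: fI.
Qed.

Lemma inj_of_card_leT (T U : Type) (B : set U) : [set: T] #<= B ->
  exists f : T -> U, (forall x, B (f x)) /\ injective f.
Proof.
move=> /card_leP[f].
exists (fun x => val (f (@SigSub _ _ _ x (mem_set I)))); split.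
  by move=> x; apply: set_valP.
move=> x y /val_inj fxy.
by have [] := congr1 val (inj (mem_set I) (mem_set I) fxy).
Qed.

(* The cofinality of the continuum is uncountable (König). *)
Lemma continuum_bigcup (U : Type) (P : nat -> set U) :
  [set: set nat] #<= \bigcup_n P n -> exists n, [set: set nat] #<= P n.
Proof.
move=> /inj_of_card_leT[f [fP fI]].
pose dec (A : set nat) (n : nat) : set nat := [set k | A (pickle (n, k))].
apply: contrapT => /forallNP nP.
(* If the [n]-th columns of the sets sent into [P n] took every value, choosing preimages would
   inject the continuum into [P n]. *)
have /choice[y yP] n : exists y, forall A, P n (f A) -> dec A n <> y.
  apply: contrapT => /forallNP nn; apply: (nP n).
  have /choice[g gP] (y : set nat) : exists A, P n (f A) /\ dec A n = y.
    by have /existsNP[A /not_implyP[? /contrapT ?]] := nn y; exists A.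
  apply: (@card_le_of_inj _ _ _ _ (f \o g)) => [y _|y z _ _ /fI gyz].
    by have [] := gP y.
  by rewrite -(proj2 (gP y)) -(proj2 (gP z)) gyz.
pose A : set nat :=
  [set j | if unpickle j is Some p then y p.1 p.2 else False].
have [n _ PnA] := fP A.
apply: (yP n A PnA); apply/seteqP; split=> k; rewrite /dec /A /= pickleK //.
Qed.

End Cardinality.

(** * Well-orders with small initial segments *)

Section WellOrder.

Record small_wo (T : Type) (lt : T -> T -> Prop) : Prop := SmallWo {
  small_wo_wf : well_founded lt;
  small_wo_total : forall x y, [\/ lt x y, x = y | lt y x];
  small_wo_seg : forall x, ~ ([set: T] #<= [set y | lt y x]) }.

(* Pull a well-order back along an injection into its shortest initial segment
   of full cardinality. *)
Lemma exists_small_wo (T : Type) : exists lt : T -> T -> Prop, small_wo lt.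
Proof.
have [R woR] := wochoice.well_ordering_principle {classic T}.
have Rmin (A : set T) : A !=set0 -> exists2 z, A z & forall y, A y -> R z y.
  move=> [a Aa]; have [|] := woR [pred x | `[< A x >]].
    by exists a; rewrite inE.
  move=> z [[]]; rewrite inE => Az zmin _; exists z => // y Ay.
  by apply: zmin; rewrite inE.
have Rxx x : R x x.
  by have [z -> /(_ x erefl)] := Rmin [set x] (ex_intro _ x erefl).
have Ranti x y : R x y -> R y x -> x = y.
  move=> xy yx; have [|] := woR [pred z | `[< z = x \/ z = y >]].
    by exists x; rewrite inE; left.
  move=> z [_ zu]; rewrite -(zu x) ?(zu y)//; split; rewrite ?inE.
  - by right.
  - by move=> w; rewrite inE => -[] ->.
  - by left.
  - by move=> w; rewrite inE => -[] ->.
have Rtot x y : R x y \/ R y x.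
  have [z [->|->] zm] := Rmin [set z | z = x \/ z = y]
    (ex_intro _ x (or_introl erefl)); [left|right]; apply: zm.
  - by right.
  - by left.
pose lt x y := ~ R y x.
have wflt : well_founded lt.
  move=> x; apply: contrapT => nx.
  have [z nz zmin] := Rmin [set x | ~ Acc lt x] (ex_intro _ x nx).
  apply: nz; constructor => y yz; apply: contrapT => ny.
  by apply: yz; exact: zmin.
have lttot x y : [\/ lt x y, x = y | lt y x].
  have [xy|xy] := pselect (R x y); last by apply: Or33.
  have [yx|yx] := pselect (R y x); last by apply: Or31.
  by apply: Or32; exact: Ranti.
have [sm|/existsNP[a0 /contrapT big0]] :=
    pselect (forall a, ~ ([set: T] #<= [set y | lt y a])).
  by exists lt; exact: SmallWo wflt lttot sm.
have [a biga amin] := Rmin [set a | [set: T] #<= [set y | lt y a]]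
  (ex_intro _ a0 big0).
have [h [ha hI]] := inj_of_card_leT biga.
exists (fun x y => lt (h x) (h y)); constructor.
- move=> x; move: {2}(h x) (erefl (h x)) => y.
  elim/(well_founded_ind wflt): y x => y IH x hx.
  by constructor => z hz; rewrite hx in hz; exact: (IH (h z) hz z erefl).
- move=> x y; have [?|/hI ?|?] := lttot (h x) (h y).
  + exact: Or31.
  + exact: Or32.
  + exact: Or33.
- move=> x Tx; apply: (ha x); apply: amin => /=.
  apply: card_le_trans Tx _.
  by apply: (@card_le_of_inj _ _ _ _ h) => // ? ? _ _ /hI.
Qed.

End WellOrder.

(** * Martin's axiom for sigma-centered preorders *)

Section MartinAxiomSigmaCentered.
Context (P : Type) (le : P -> P -> Prop) (c : P -> nat)
  (lexx : forall p, le p p)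
  (le_trans : forall p q r, le p q -> le q r -> le p r)
  (c_compat : forall p q, c p = c q -> exists r, le r p /\ le r q).

Definition preorder_dense (D : set P) := forall p, exists2 q, D q & le q p.

(* Martin's axiom is about partial orders; the second coordinate separates
   equivalent elements of the preorder [le]. *)
Let Q : Type := {classic P * nat}.
HB.instance Definition _ := Choice.on Q.
Let leQ (p q : Q) : bool := (p == q) || `[< le p.1 q.1 /\ (q.2 < p.2)%N >].

Let leQxx : reflexive leQ. Proof. by move=> p; rewrite /leQ eqxx. Qed.

Let leQ_anti : antisymmetric leQ.
Proof.
move=> p q /andP[/orP[/eqP->//|/asboolP[_ pq]]] /orP[/eqP->//|/asboolP[_ qp]].
by have := ltn_trans pq qp; rewrite ltnn.
Qed.

Let leQ_trans : transitive leQ.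
Proof.
move=> q p r /orP[/eqP->//|/asboolP[pq npq]] /orP[/eqP<-|/asboolP[qr nqr]].
  by apply/orP; right; apply/asboolP.
apply/orP; right; apply/asboolP; split; first exact: le_trans pq qr.
exact: ltn_trans nqr npq.
Qed.

Fact sigma_centered_display : Order.disp_t. Proof. exact: Order.Disp tt tt. Qed.

HB.instance Definition _ := Order.Le_isPOrder.Build sigma_centered_display Q
  leQxx leQ_anti leQ_trans.

(** Equal values of [c] force compatibility, whence ccc. The dense sets form a countable union of
    small families, which is small by [continuum_bigcup]. *)
Lemma sigma_centered_MA (I : Type) (A : set I) (D : I -> nat -> set P)
    (E : nat -> set P) : MartinAxiom -> inhabited P ->
  less_than_continuum A ->
  (forall i n, A i -> preorder_dense (D i n)) ->
  (forall n, preorder_dense (E n)) ->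
  exists G : set P, [/\
    forall p q, G p -> G q -> exists r, [/\ G r, le r p & le r q],
    forall i n, A i -> G `&` D i n !=set0 &
    forall n, G `&` E n !=set0].
Proof.
move=> MA [p0] [Ac cA] Ddense Edense.
pose lift (X : set P) : set Q := [set p | X p.1].
pose DD : set (set Q) :=
  \bigcup_n if odd n then [set lift (E n./2)]
             else (fun i => lift (D i n./2)) @` A.
have leP (p q : Q) : le p.1 q.1 -> (q.2 < p.2)%N -> (p <= q)%O.
  by move=> ? ?; apply/orP; right; apply/asboolP.
have leQ1 (p q : Q) : (p <= q)%O -> le p.1 q.1.
  by move=> /orP[/eqP->//|/asboolP[]].
have [] := MA sigma_centered_display Q DD.
- exact: inhabits (p0, 0%N).
- move=> X Xanti.
  apply: (@card_le_of_inj _ _ _ _ (fun p : Q => pickle (c p.1, p.2))) => //.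
  move=> p q Xp Xq /(pcan_inj pickleK)[cpq _]; apply: contrapT => pq.
  apply: (Xanti p q Xp Xq pq); have [r [rp rq]] := c_compat cpq.
  exists (r, (maxn p.2 q.2).+1); split; apply: leP => //=.
    by rewrite ltnS leq_maxl.
  by rewrite ltnS leq_maxr.
- split.
    pose dd (no : nat * option I) :=
      if no.2 is Some i then lift (D i no.1./2) else lift (E no.1./2).
    have /choice[k kP] X : exists no : nat * option I, DD X ->
        (forall i, no.2 = Some i -> A i) /\ X = dd no.
      have [DX|nDX] := pselect (DD X); last by exists (0%N, None).
      move: DX => [n _]; case: ifP => [_ ->|_ [i Ai <-]].
        by exists (n, None).
      by exists (n, Some i) => _; split => // _ [<-].
    have [h hI] : exists h : I -> set nat,
        forall i j, A i -> A j -> h i = h j -> i = j.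
      move: Ac => /pcard_leTP[h]; exists h => i j Ai Aj.
      exact: (inj (mem_set Ai) (mem_set Aj)).
    (* Column 0 records the number, column 1 the set [h i]; the later columns tell [Some] from
       [None] even when [h i] is empty. *)
    pose code (no : nat * option I) : set nat := [set m |
      match unpickle m with
      | Some (0, m) => m = no.1
      | Some (1, m) => if no.2 is Some i then h i m else False
      | Some (_, _) => no.2 <> None
      | None => False end].
    have codeE no (m l : nat) : code no (pickle (m, l)) = match m with
      | 0 => l = no.1
      | 1 => if no.2 is Some i then h i l else False
      | _ => no.2 <> None end by rewrite /code /= pickleK.
    apply: (@card_le_of_inj _ _ _ _ (code \o k)) => // X Y DX DY /= XY.
    have [kX ->] := kP X DX; have [kY ->] := kP Y DY.
    have cE (m l : nat) :
      code (k X) (pickle (m, l)) = code (k Y) (pickle (m, l)) by rewrite XY.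
    have := cE 0 (k X).1; have := cE 2 0; have := cE 1; rewrite !codeE.
    move: kX kY; case: (k X) (k Y) => [n [i|]] [n' [j|]] /= kX kY e1 e2 e0.
    + have <- : n = n' by rewrite -e0.
      congr (dd (_, Some _)); apply: hI; [exact: kX|exact: kY|].
      by apply/seteqP; split => l; have := e1 l; rewrite !codeE /= => ->.
    + by have : None <> None :> option I by rewrite -e2.
    + by have : None <> None :> option I by rewrite e2.
    + by have <- : n = n' by rewrite -e0.
  move=> /continuum_bigcup[n]; case: ifP => _.
    move=> /inj_of_card_leT[f [fE fI]].
    have : [set: nat] = set0 by apply: fI; rewrite !fE.
    by move/seteqP => -[/(_ 0%N Logic.I)].
  by move=> cD; apply: cA; apply: card_le_trans cD (card_image_le _ _).
- move=> X [n _]; case: ifP => _; last first.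
    move=> [i Ai <-] [p m]; have [q Dq qp] := Ddense i n./2 Ai p.
    by exists (q, m.+1) => //; exact: leP.
  move=> -> [p m]; have [q Eq qp] := Edense n./2 p.
  by exists (q, m.+1) => //; exact: leP.
move=> G [[G0 Gup Gdir] GD].
exists [set p | exists n, G (p, n)]; split.
- move=> p q [n Gp] [m Gq].
  have [[r k] [Gr /leQ1 rp /leQ1 rq]] := Gdir _ _ Gp Gq.
  by exists r; split => //; exists k.
- move=> i n Ai; have [|[p k] [Gp Dp]] := GD (lift (D i n)).
    by exists n.*2 => //; rewrite odd_double doubleK; exists i.
  by exists p; split => //; exists k.
- move=> n; have [|[p k] [Gp Dp]] := GD (lift (E n)).
    by exists n.*2.+1 => //=; rewrite odd_double /= uphalf_double.
  by exists p; split => //; exists k.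
Qed.

End MartinAxiomSigmaCentered.

(** * The Baire space and its coarser topology *)

Section BaireSpace.

Definition baire : Type := nat -> nat.
HB.instance Definition _ := Choice.on baire.

Definition agree (m : nat) (x y : baire) := forall j, (j < m)%N -> x j = y j.

Definition cyl (s : seq nat) : set baire :=
  [set x | agree (size s) x (nth 0%N s)].

Lemma agree_sym m x y : agree m x y -> agree m y x.
Proof. by move=> xy j /xy. Qed.

Lemma agree_trans m x y z : agree m x y -> agree m y z -> agree m x z.
Proof. by move=> xy yz j jm; rewrite xy ?yz. Qed.

Lemma agree_le m n x y : (m <= n)%N -> agree n x y -> agree m x y.
Proof. by move=> mn xy j jm; apply: xy; exact: leq_trans jm mn. Qed.

Lemma cyl_mkseq (x : baire) m y : cyl (mkseq x m) y <-> agree m y x.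
Proof.
by rewrite /cyl /= size_mkseq; split => yx j jm; rewrite yx// nth_mkseq.
Qed.

Lemma cyl_cat s t x : cyl (s ++ t) x -> cyl s x.
Proof.
move=> stx j js; rewrite stx ?nth_cat ?js//.
by rewrite size_cat (leq_trans js) ?leq_addr.
Qed.

Lemma cyl_agree s x y : cyl s x -> agree (size s) x y -> cyl s y.
Proof. by move=> sx /agree_sym xy; exact: agree_trans xy sx. Qed.

Lemma cyl_extend s x m : cyl s x ->
  exists t, forall y, cyl (s ++ t) y -> agree m y x.
Proof.
move=> sx; exists (mkseq (fun j => x (j + size s)%N) m) => y sy j jm.
have [js|js] := ltnP j (size s); first by rewrite sx// (cyl_cat sy js).
rewrite sy ?size_cat ?size_mkseq ?(leq_trans jm) ?leq_addl//.
rewrite nth_cat ltnNge js /= nth_mkseq ?subnK//.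
exact: leq_ltn_trans (leq_subr _ _) jm.
Qed.

Lemma seq_bound (T : eqType) (f : T -> nat) (l : seq T) :
  exists v, forall a, a \in l -> (f a < v)%N.
Proof.
elim: l => [|b l [v lv]]; first by exists 0%N.
exists (maxn v (f b).+1) => a; rewrite inE => /orP[/eqP->|/lv av].
  by rewrite leq_max leqnn orbT.
by rewrite leq_max av.
Qed.

(* The coordinates of [enc x] are the truth values of [x n = k + 1], so the
   topology induced by [enc] is that of the product of convergent sequences
   in which the values tend to [0]. *)
Definition enc (x : baire) : baire := fun j =>
  if unpickle j is Some p then (x (p.1 : nat) == (p.2 : nat).+1 : nat) else 0%N.

Lemma encE x (n k : nat) : enc x (pickle (n, k)) = (x n == k.+1).
Proof. by rewrite /enc pickleK. Qed.

Lemma enc_inj : injective enc.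
Proof.
move=> x y exy; apply/funext => n.
have e k : (x n == k.+1) = (y n == k.+1).
  have := congr1 (fun z => z (pickle (n, k))) exy; rewrite !encE.
  by case: eqP; case: eqP.
case E : (y n) => [|k]; last by apply/eqP; rewrite e E.
by case F : (x n) => [//|k]; have := e k; rewrite E F eqxx.
Qed.

Lemma enc_bound L : exists v, forall j (p : nat * nat), (j < L)%N ->
  unpickle j = Some p -> (p.1 < v)%N /\ (p.2 < v)%N.
Proof.
have [v vP] := seq_bound (fun j => if unpickle j is Some p
   then maxn (p.1 : nat) (p.2 : nat) else 0%N) (iota 0 L).
exists v => j p jL jp; have := vP j; rewrite mem_iota jL jp => /(_ isT).
by rewrite gtn_max => /andP[].
Qed.

Lemma enc_cont L : exists M, forall y z,
  agree M y z -> agree L (enc y) (enc z).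
Proof.
have [M MP] := enc_bound L; exists M => y z yz j jL; rewrite /enc.
by case jp : unpickle => [p|//]; rewrite yz//; have [] := MP j p jL jp.
Qed.

(** Where [x] leaves the cylinder, [x j] and the prescribed value differ, so one of them is some
    [k.+1]; the coordinate of [enc] testing for [k.+1] tells them apart. *)
Lemma cyl_closed s x : ~ cyl s x ->
  exists L, forall y, agree L (enc x) (enc y) -> ~ cyl s y.
Proof.
move=> /existsNP[j /not_implyP[js xj]].
have key k : (x j == k.+1) != (nth 0%N s j == k.+1) ->
    exists L, forall y, agree L (enc x) (enc y) -> ~ cyl s y.
  move=> ne; exists (pickle (j, k)).+1 => y /(_ (pickle (j, k)) (ltnSn _)).
  rewrite !encE => e sy; move: ne; rewrite -(sy j js); move: e.
  by do 2 case: eqP.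
case E : (x j) => [|k]; last first.
  by apply: (key k); rewrite -E eqxx; apply/eqP => /esym/eqP sx; apply: xj.
case F : (nth 0%N s j) => [|k]; first by move: xj; rewrite E F.
by apply: (key k); rewrite E F eqxx.
Qed.

Lemma enc_separate (l : seq baire) y : y \notin l ->
  exists L, forall a, a \in l -> ~ agree L (enc a) (enc y).
Proof.
elim: l => [|b l IH]; first by exists 0%N.
rewrite inE negb_or => /andP[/eqP yb /IH[L LP]].
have [j ej] : exists j, enc b j <> enc y j.
  apply: contrapT => /forallNP e; apply: yb; apply: enc_inj; apply/funext => j.
  by have /contrapT -> := e j.
exists (maxn L j.+1) => a; rewrite inE => /orP[/eqP->|al] aL.
  by apply: ej; apply: aL; rewrite leq_max leqnn orbT.
by apply: (LP a al); apply: agree_le aL; rewrite leq_max leqnn.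
Qed.

(* Every meager set of the Baire space lies in some [meager_of phi], where
   [s ++ phi n s] is a cylinder inside [s] missing the [n]-th nowhere dense
   set. *)
Definition meager_of (phi : nat -> seq nat -> seq nat) : set baire :=
  [set x | exists n, forall s, ~ cyl (s ++ phi n s) x].

(** [W m] lists coarse cylinders whose union is the complement of the [m]-th closed set. *)
Definition Fsigma_of (W : nat -> set (seq nat)) : set baire :=
  [set x | exists m, forall s, W m s -> ~ cyl s (enc x)].

End BaireSpace.

(** * Cohen forcing, and the forcing of a separating F_sigma set *)

Section Forcing.
Context (MA : MartinAxiom) (I : Type) (A : set I)
  (Asmall : less_than_continuum A).

(** Conditions are finite sequences appended to [s]; being countably many, they are trivially
    sigma-centered. [psi] goes into the countable list of dense sets, so [A] is not enlarged. *)
Lemma cohen_real (phi : I -> nat -> seq nat -> seq nat)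
    (psi : nat -> seq nat -> seq nat) (s : seq nat) :
  exists x : baire, [/\ cyl s x, forall i, A i -> ~ meager_of (phi i) x &
    ~ meager_of psi x].
Proof.
pose le (p q : seq nat) := prefix q p.
pose B (phi : nat -> seq nat -> seq nat) n : set (seq nat) :=
  [set t | exists u, prefix (u ++ phi n u) (s ++ t)].
have Bdense chi n : preorder_dense le (B chi n).
  move=> p; exists (p ++ chi n (s ++ p)); last exact: prefix_prefix.
  by exists (s ++ p); rewrite catA prefix_refl.
pose E n := if odd n then B psi n./2 else [set t | (n./2 < size t)%N].
have [||||||G [Gdir GD GE]] := @sigma_centered_MA _ le pickle _ _ _ I A
  (fun i => B (phi i)) E MA _ Asmall.
- exact: prefix_refl.
- by move=> p q r pq qr; exact: prefix_trans qr pq.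
- by move=> p q /(pcan_inj pickleK) ->; exists q; split; exact: prefix_refl.
- exact: inhabits [::].
- by move=> i n _; exact: Bdense.
- move=> n; rewrite /E; case: ifP => // _ p.
  exists (p ++ nseq n./2.+1 0%N); last exact: prefix_prefix.
  by rewrite /mkset size_cat /= size_nseq addnS ltnS leq_addl.
have /choice[t tP] j : exists t, G t /\ (j < size t)%N.
  have [t [Gt]] := GE j.*2; rewrite /E odd_double doubleK => jt.
  by exists t.
pose x : baire := fun j => nth 0%N (s ++ t j) j.
have Gx p : G p -> cyl (s ++ p) x.
  move=> Gp j jp; have [Gt jt] := tP j.
  have [r [_ /prefixP[p' rp] /prefixP[t' rt]]] := Gdir _ _ Gp Gt.
  have -> : nth 0%N (s ++ p) j = nth 0%N (s ++ r) j.
    by rewrite rp catA (nth_cat _ (s ++ p)) jp.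
  by rewrite rt catA (nth_cat _ (s ++ t j)) size_cat (leq_trans jt) ?leq_addl.
have notin chi n p : G p -> B chi n p -> exists u, cyl (u ++ chi n u) x.
  move=> /Gx xp [u /prefixP[v uv]]; exists u.
  by move: xp; rewrite uv; exact: cyl_cat.
exists x; split.
- by have [p [/Gx/cyl_cat]] := GE 0%N.
- move=> i Ai [n xn]; have [p [Gp Bp]] := GD i n Ai.
  by have [u /xn] := notin _ _ _ Gp Bp.
- move=> [n xn]; have [p [Gp]] := GE n.*2.+1.
  rewrite /E /= odd_double /= uphalf_double => Bp.
  by have [u /xn] := notin _ _ _ Gp Bp.
Qed.

(* A condition [(w, q)] promises that the [m]-th closed set misses [cyl u]
   for [(m, u)] in [w], and that it contains [a] for [(m, a)] in [q]. *)
Definition separating_condition (N : set baire)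
    (p : seq (nat * seq nat) * seq (nat * baire)) : Prop :=
  (forall (m : nat) a, (m, a) \in p.2 -> N a) /\
  forall (m : nat) (u : seq nat) a,
    (m, u) \in p.1 -> (m, a) \in p.2 -> ~ cyl u (enc a).

(** The first component of a condition has countably many values, and conditions sharing it become
    compatible by joining their second components. *)
Lemma separating_Fsigma (x : I -> baire) (N : set baire) :
  exists W phi, (forall i, A i -> (Fsigma_of W (x i) <-> N (x i))) /\
    Fsigma_of W `<=` meager_of phi.
Proof.
pose P := {p | separating_condition N p}.
pose le (p q : P) := {subset (sval q).1 <= (sval p).1} /\
                     {subset (sval q).2 <= (sval p).2}.
have lexx p : le p p by split.
have addW (p : P) m y : ~ (exists2 a, (m, a) \in (sval p).2 & a = y) ->
    exists L q, le q p /\ (m, mkseq (enc y) L) \in (sval q).1.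
  move=> ypN; pose l := [seq e.2 | e <- (sval p).2 & e.1 == m].
  have [|L LP] := @enc_separate l y.
    apply/negP => /mapP[[m' a]]; rewrite mem_filter => /andP[/= /eqP-> ap ya].
    by apply: ypN; exists a.
  exists L.
  have qP : separating_condition N
      ((m, mkseq (enc y) L) :: (sval p).1, (sval p).2).
    split; first exact: (proj1 (svalP p)).
    move=> m' u a; rewrite inE => /orP[/eqP[-> ->] ap /cyl_mkseq|]; last first.
      exact: (proj2 (svalP p)).
    by apply: LP; apply/mapP; exists (m, a) => //; rewrite mem_filter /= eqxx.
  exists (exist _ ((m, mkseq (enc y) L) :: (sval p).1, (sval p).2) qP).
  split; last by rewrite /= inE eqxx.
  by split => //= e; rewrite inE orbC => ->.
(* [D i m] puts [x i] into some closed set if it lies in [N], and otherwise expels it from the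
   [m]-th one. *)
pose D i m : set P := [set p |
  (N (x i) -> exists m', (m', x i) \in (sval p).2) /\
  (~ N (x i) -> exists2 u, (m, u) \in (sval p).1 & cyl u (enc (x i)))].
(* For [k] coding [(m, s)], a fine cylinder inside [s] is removed from the [m]-th closed set, which
   thus becomes finely nowhere dense. *)
pose E k : set P := if unpickle k is Some e then
    [set p | exists t u, ((e.1 : nat), u) \in (sval p).1 /\
      forall y, cyl ((e.2 : seq nat) ++ t) y -> cyl u (enc y)]
  else setT.
have [|||||G [Gdir GD GE]] := @sigma_centered_MA P le
  (fun p => pickle (sval p).1) lexx _ _ I A D E MA _ Asmall.
- by move=> p q r [pq1 pq2] [qr1 qr2]; split => e => [/qr1/pq1|/qr2/pq2].
- move=> p q /(pcan_inj pickleK) pq.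
  have rP : separating_condition N ((sval p).1, (sval p).2 ++ (sval q).2).
    split.
      move=> m a; rewrite mem_cat => /orP[]; first exact: (proj1 (svalP p)).
      exact: (proj1 (svalP q)).
    move=> m u a mu; rewrite mem_cat => /orP[].
      exact: (proj2 (svalP p)).
    by apply: (proj2 (svalP q)); rewrite -pq.
  exists (exist _ ((sval p).1, (sval p).2 ++ (sval q).2) rP).
  split; split => e //=; rewrite ?mem_cat ?pq// => ->; rewrite ?orbT//.
- have P0 : separating_condition N ([::], [::]) by [].
  exact: inhabits (exist _ ([::], [::]) P0).
- move=> i m _ p; have [Nx|Nx] := pselect (N (x i)).
    (* The index [v] is fresh for the first component, so the new promise conflicts with no
       cylinder. *)
    have [v vP] := seq_bound fst (sval p).1.
    have qP : separating_condition N ((sval p).1, (v, x i) :: (sval p).2).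
      split.
        move=> m' a; rewrite inE => /orP[/eqP[_ ->]//|].
        exact: (proj1 (svalP p)).
      move=> m' u a mu; rewrite inE => /orP[/eqP[mv _]|]; last first.
        exact: (proj2 (svalP p)).
      by have := vP _ mu; rewrite /= mv ltnn.
    exists (exist _ ((sval p).1, (v, x i) :: (sval p).2) qP).
      by split => // _; exists v; rewrite /= inE eqxx.
    by split => //= e; rewrite inE orbC => ->.
  have [|L [q [qp mq]]] := addW p m (x i).
    by move=> [a /(proj1 (svalP p)) Na ax]; apply: Nx; rewrite -ax.
  exists q => //; split => // _; exists (mkseq (enc (x i)) L) => //.
  exact/cyl_mkseq.
- move=> k p; rewrite /E; case: unpickle => [[m s]|]; last by exists p.
  (* At coordinate [size s] the value [v] exceeds that of every promised point, so [y] lies in the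
     cylinder [s] and is none of them. *)
  have [v vP] := seq_bound (fun e : nat * baire => e.2 (size s)) (sval p).2.
  pose y : baire := fun j => if (j < size s)%N then nth 0%N s j else v.
  have [|L [q [qp mq]]] := addW p m y.
    by move=> [a /vP /= + ay]; rewrite ay /y !ltnn.
  exists q => //; have [M MP] := enc_cont L.
  have [t st] : exists t, forall z, cyl (s ++ t) z -> agree M z y.
    by apply: cyl_extend => j js; rewrite /y js.
  exists t, (mkseq (enc y) L); split => // z sz.
  by apply/cyl_mkseq/MP; exact: st.
pose W m : set (seq nat) := [set u | exists2 p, G p & (m, u) \in (sval p).1].
have /choice[phi phiP] (ms : nat * seq nat) : exists t, exists2 u, W ms.1 u &
    forall y, cyl (ms.2 ++ t) y -> cyl u (enc y).
  have [p [Gp]] := GE (pickle ms); rewrite /E pickleK => -[t [u [mu yu]]].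
  by exists t, u => //; exists p.
exists W, (fun n s => phi (n, s)); split; last first.
  move=> y [m my]; exists m => s h.
  by have [u Wu /(_ _ h)] := phiP (m, s); exact: my.
move=> i Ai; split.
  move=> [m mW]; apply: contrapT => Nx.
  have [p [Gp [_ /(_ Nx)[u mu]]]] := GD i m Ai.
  by apply: mW; exists p.
move=> Nx; have [p [Gp [/(_ Nx)[m mx] _]]] := GD i 0%N Ai.
exists m => u [q Gq mu].
have [r [Gr [_ rp] [rq _]]] := Gdir _ _ Gp Gq.
by apply: (proj2 (svalP r)); [exact: rq mu|exact: rp mx].
Qed.

End Forcing.

(** * Transfinite recursion and the Luzin-type set *)

Section Construction.

(** A choice function is fixed once on all pairs [(a, f)]. The recursion feeds it the values below
    [a] padded with [v0]; as [Q] reads [f] only below [a], the padding is harmless. *)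
Lemma wf_choice (T V : Type) (lt : T -> T -> Prop)
    (Q : T -> (T -> V) -> V -> Prop) :
  inhabited V -> well_founded lt ->
  (forall a f g v, (forall b, lt b a -> f b = g b) -> Q a f v -> Q a g v) ->
  (forall a f, exists v, Q a f v) ->
  exists f, forall a, Q a f (f a).
Proof.
move=> [v0] wf Qext Qex.
have /choice[F FP] (af : T * (T -> V)) : exists v, Q af.1 af.2 v by exact: Qex.
pose restr a (rec : forall b, lt b a -> V) b :=
  if pselect (lt b a) is left h then rec b h else v0.
pose step a (rec : forall b, lt b a -> V) := F (a, @restr a rec).
pose f := Fix wf (fun _ => V) step.
exists f => a.
have -> : f a = step a (fun b _ => f b).
  rewrite /f Fix_eq// => b g h gh; congr (F (_, _)); apply/funext => c.
  by rewrite /restr; case: pselect => // ?; rewrite gh.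
apply: Qext (FP (a, _)) => b ba.
by rewrite /= /restr; case: pselect.
Qed.

Definition meager_join (phi psi : nat -> seq nat -> seq nat) n :=
  if odd n then phi n./2 else psi n./2.

Lemma meager_joinl phi psi : meager_of phi `<=` meager_of (meager_join phi psi).
Proof.
move=> x [n xn]; exists n.*2.+1.
by rewrite /meager_join /= odd_double /= uphalf_double.
Qed.

Lemma meager_joinr phi psi : meager_of psi `<=` meager_of (meager_join phi psi).
Proof.
by move=> x [n xn]; exists n.*2; rewrite /meager_join odd_double doubleK.
Qed.

(** A stage is a cylinder paired with a meager set, so each such pair is served at the stage it
    names. *)
Let code : Type := (seq nat * (nat -> seq nat -> seq nat))%type.

Lemma card_le_code : [set: code] #<= [set: set nat].
Proof.
pose h (a : code) : set nat := [set k |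
  match unpickle k : option (seq nat + nat * seq nat * seq nat)%type with
  | Some (inl s) => s = a.1
  | Some (inr e) => a.2 e.1.1 e.1.2 = e.2
  | None => False end].
apply: (@card_le_of_inj _ _ _ _ h) => // -[s phi] [t psi] _ _ E.
have hs a : h a (pickle (inl s : (seq nat + nat * seq nat * seq nat)%type)) =
    (s = a.1) by rewrite /h /mkset pickleK.
congr (_, _); first by rewrite -[t]/((t, psi).1) -hs -E hs.
apply/funext => n; apply/funext => u.
pose e : seq nat + nat * seq nat * seq nat := inr (n, u, phi n u).
have he a : h a (pickle e) = (a.2 n u = phi n u) by rewrite /h /mkset pickleK.
have : h (s, phi) (pickle e) by rewrite he.
by rewrite E he => /esym.
Qed.

(* Under CH any Luzin set of the Baire space would do. *)
Lemma exists_Luzin_set : MartinAxiom -> exists S : set baire,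
  (forall s phi, exists x, [/\ S x, cyl s x & ~ meager_of phi x]) /\
  (forall phi, exists W, forall x, S x -> (meager_of phi x <-> Fsigma_of W x)).
Proof.
move=> MA; have [lt [wf total seg]] := exists_small_wo code.
have small a : less_than_continuum [set b | lt b a].
  split; first exact: card_le_trans (card_leT _) card_le_code.
  by move=> c; apply: (seg a); exact: card_le_trans card_le_code c.
(* The new point, a meager set covering the F_sigma set of the stage, and a code of that F_sigma
   set. *)
pose V : Type :=
  (baire * (nat -> seq nat -> seq nat) * (nat -> set (seq nat)))%type.
pose Q (a : code) (f : code -> V) (v : V) := [/\
  forall b, lt b a -> Fsigma_of v.2 (f b).1.1 <-> meager_of a.2 (f b).1.1,
  Fsigma_of v.2 `<=` meager_of v.1.2,
  cyl a.1 v.1.1,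
  forall b, lt b a -> ~ meager_of b.2 v.1.1 /\ ~ meager_of (f b).1.2 v.1.1 &
  ~ meager_of a.2 v.1.1 /\ ~ meager_of v.1.2 v.1.1].
have [|||f fP] := @wf_choice code V lt Q _ wf.
- exact: inhabits ((fun=> 0%N), (fun _ _ => [::]), (fun=> set0)).
- move=> a f g v fg [h1 h2 h3 h4 h5]; split => // b ba.
    by rewrite -fg//; exact: h1.
  by rewrite -fg//; exact: h4.
- move=> a f.
  have [W [phi [WP Wphi]]] := separating_Fsigma MA (small a)
    (fun b => (f b).1.1) (meager_of a.2).
  have [x [sx xb xa]] := cohen_real MA (small a)
    (fun b => meager_join b.2 (f b).1.2) (meager_join a.2 phi) a.1.
  exists (x, phi, W); split => //.
    move=> b ba; split=> xm; apply: (xb b ba).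
      exact: meager_joinl.
    exact: meager_joinr.
  split=> xm; apply: xa.
    exact: meager_joinl.
  exact: meager_joinr.
exists (range (fun a => (f a).1.1)); split.
  move=> s phi; have [_ _ ? _ [? _]] := fP (s, phi).
  by exists (f (s, phi)).1.1; split => //; exists (s, phi).
move=> phi; pose b : code := ([::], phi); exists (f b).2 => _ [a _ <-].
have [b1 b2 _ _ b5] := fP b.
(* The forcing of stage [b] handles the points chosen before; the point of stage [b] and all later
   ones avoid both sets. *)
have [ab|->|ba] := total a b.
- by apply: iff_sym; exact: b1.
- by split=> [/(proj1 b5)|/b2/(proj2 b5)].
- have [_ _ _ /(_ b ba)[a4 a4'] _] := fP a.
  by split=> [/a4|/b2/a4'].
Qed.

End Construction.

(** * Topologies induced from the Baire space *)

Section PrefixSpace.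
Context (U : Type) (i : U -> baire).

(* [U] with the topology induced by [i] from the Baire space. *)
Definition prefix_space of (U -> baire) := U.
Local Notation X := (prefix_space i).

HB.instance Definition _ := gen_eqMixin X.
HB.instance Definition _ := gen_choiceMixin X.

Definition prefix_open : set (set X) := [set O | forall x, O x ->
  exists m, forall y, agree m (i x) (i y) -> O y].

Let prefix_openT : prefix_open setT. Proof. by move=> x _; exists 0%N. Qed.

Let prefix_openI : setI_closed prefix_open.
Proof.
move=> A B oA oB x [/oA[m mA] /oB[n nB]]; exists (maxn m n) => y xy; split.
  by apply: mA; apply: agree_le xy; exact: leq_maxl.
by apply: nB; apply: agree_le xy; exact: leq_maxr.
Qed.

Let prefix_open_bigU (I : Type) (f : I -> set X) :
  (forall k, prefix_open (f k)) -> prefix_open (\bigcup_k f k).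
Proof.
by move=> fo x [k _ /(fo k)[m mf]]; exists m => y /mf fy; exists k.
Qed.

HB.instance Definition _ := @isOpenTopological.Build X
  prefix_open prefix_openT prefix_openI prefix_open_bigU.

Lemma prefix_openE (O : set X) : open O <-> forall x, O x ->
  exists m, forall y, agree m (i x) (i y) -> O y.
Proof. by []. Qed.

Lemma prefix_separable (u0 : U) : separable X.
Proof.
have /choice[g gP] (s : seq nat) :
    exists u : U, (exists v, cyl s (i v)) -> cyl s (i u).
  have [[v sv]|nv] := pselect (exists v, cyl s (i v)); first by exists v.
  by exists u0.
exists (range g).
  by apply: card_le_trans (card_image_le _ _) _; exact: countableP.
move=> O [x Ox] /prefix_openE/(_ x Ox)[m mO].
exists (g (mkseq (i x) m)); split; last by exists (mkseq (i x) m).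
apply: mO; apply: agree_sym; apply/cyl_mkseq; apply: gP.
by exists x; apply/cyl_mkseq.
Qed.

Local Open Scope ring_scope.
Import Order.TTheory GRing.Theory Num.Theory.

Lemma prefix_metrizable (R : realType) : injective i -> metrizable R X.
Proof.
move=> iI.
have /choice[d0 dP] (xy : X * X) : exists d : R, (xy.1 = xy.2 /\ d = 0) \/
    exists n, [/\ agree n (i xy.1) (i xy.2), i xy.1 n <> i xy.2 n &
      d = n.+1%:R^-1].
  have [->|ne] := pselect (xy.1 = xy.2); first by exists 0; left.
  have ex : exists n, i xy.1 n != i xy.2 n.
    apply: contrapT => /forallNP e; apply: ne; apply: iI; apply/funext => n.
    by have /negP/negPn/eqP := e n.
  case: (ex_minnP ex) => n /eqP en nmin.
  exists n.+1%:R^-1; right; exists n; split => // j jn.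
  by apply/eqP; apply: contraTT jn => /nmin; rewrite -leqNgt.
pose d x y := d0 (x, y).
have invS (m n : nat) : (m <= n)%N -> n.+1%:R^-1 <= m.+1%:R^-1 :> R.
  by move=> mn; rewrite lef_pV2 ?posrE ?ltr0n// ler_nat.
have d_ge0 x y : 0 <= d x y.
  rewrite /d; have [[_ ->]//|[n [_ _ ->]]] := dP (x, y).
  by rewrite invr_ge0 ler0n.
have d_diff x y n : i x n <> i y n -> n.+1%:R^-1 <= d x y.
  move=> xyn; have [[/= xy _]|[m [/= xym _ dE]]] := dP (x, y).
    by case: xyn; rewrite xy.
  rewrite /d dE; apply: invS; rewrite leqNgt; apply/negP => nm.
  by apply: xyn; exact: xym.
have d_agree x y m : agree m.+1 (i x) (i y) -> d x y < m.+1%:R^-1.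
  move=> xym; rewrite /d; have [[_ ->]|[n [_ /= xyn ->]]] := dP (x, y).
    by rewrite invr_gt0 ltr0n.
  rewrite ltf_pV2 ?posrE ?ltr0n// ltr_nat ltnS ltnNge.
  by apply/negP => nm; apply: xyn; exact: xym.
have d_sym_le x y : d x y <= d y x.
  rewrite {1}/d; have [[_ ->]|[n [_ /= xyn ->]]] := dP (x, y).
    exact: d_ge0.
  by apply: d_diff => /esym.
exists d; split; first split => //.
- move=> x y; split => [|->].
    rewrite /d; have [[]//|[n [_ _ ->]]] := dP (x, y).
    by move=> /eqP; rewrite invr_eq0 pnatr_eq0.
  by rewrite /d; have [[]//|[n []]] := dP (y, y).
- by move=> x y; apply/eqP; rewrite eq_le !d_sym_le.
- move=> x y z; rewrite {1}/d; have [[_ ->]|[n [_ /= xzn ->]]] := dP (x, z).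
    exact: addr_ge0.
  (* At the first coordinate where [x] and [z] differ, [y] differs from one of them, so one summand
     alone suffices. *)
  have [xyn|xyn] := eqVneq (i x n) (i y n).
    rewrite -[leLHS]add0r lerD//; apply: d_diff; rewrite -xyn.
    exact: xzn.
  by rewrite -[leLHS]addr0 lerD//; apply: d_diff; exact/eqP.
move=> O; split.
  move=> /prefix_openE oO x /oO[m mO]; exists m.+1%:R^-1.
    by rewrite invr_gt0 ltr0n.
  move=> y /= xy; apply: mO => j jm; apply: contrapT => /d_diff.
  by rewrite leNgt (lt_le_trans xy)// invS// ltnW.
move=> Od; apply/prefix_openE => x /Od[e e0 eO].
have [m me] : exists m, m.+1%:R^-1 < e.
  have [m me] := ltr_add_invr (e0 : 0 < e); exists m.
  by rewrite add0r in me.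
exists m.+1 => y /d_agree xy; apply: eO; exact: lt_trans xy me.
Qed.

End PrefixSpace.

(** * The identity of a Luzin-type set between the two topologies *)

Section LuzinSet.
Context (S : set baire)
  (Snm : forall s phi, exists x, [/\ S x, cyl s x & ~ meager_of phi x])
  (Sfs : forall phi, exists W, forall x, S x ->
    (meager_of phi x <-> Fsigma_of W x)).

Let U : Type := {x | S x}.
Let X : topologicalType := prefix_space (fun u : U => enc (sval u)).
Let Y : topologicalType := prefix_space (fun u : U => sval u).
Let f : X -> Y := fun u => u.

Let Sdense s : exists u : U, cyl s (sval u).
Proof.
by have [x [Sx sx _]] := Snm s (fun _ _ => [::]); exists (exist _ x Sx).
Qed.

Let open_enc (O : set X) : open O -> forall x, O x ->
  exists m, forall y : U, agree m (sval x) (sval y) -> O y.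
Proof.
move=> /prefix_openE oO x /oO[L LO]; have [M MP] := enc_cont L.
by exists M => y /MP/LO.
Qed.

Lemma id_Gdelta_measurable : Gdelta_measurable_map f.
Proof.
move=> O /prefix_openE oO.
pose inO (s : seq nat) := forall u : U, cyl s (sval u) -> O u.
pose offO (s : seq nat) := forall u : U, cyl s (sval u) -> ~ O u.
(* [t s] leads into [O] whenever [O] meets the cylinder, and is empty if the cylinder lies in [O].
   So [meager_of phi] misses [O] and covers its complement up to exterior cylinders. *)
have /choice[t tP] (s : seq nat) : exists t, (inO s -> t = [::]) /\
    (~ offO s -> inO (s ++ t)).
  have [sO|sO] := pselect (inO s); first by exists [::]; rewrite cats0.
  have [offs|/existsNP[x /not_implyP[sx /contrapT Ox]]] := pselect (offO s).
    by exists [::].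
  have [m mO] := oO x Ox.
  have [t st] := cyl_extend m sx; exists t; split => // _ y sy.
  by apply: mO; apply: agree_sym; exact: st.
pose phi (n : nat) s := t s.
have phiO (x : U) : O x -> ~ meager_of phi (sval x).
  move=> Ox [n xn]; have [m mO] := oO x Ox.
  apply: (xn (mkseq (sval x) m)); rewrite /phi (proj1 (tP _)) ?cats0.
    exact/cyl_mkseq.
  by move=> u /cyl_mkseq/agree_sym; exact: mO.
have phiN (x : U) : ~ O x -> ~ meager_of phi (sval x) ->
    exists2 s, offO s & cyl s (sval x).
  move=> nOx nx; apply: contrapT => ns; apply: nx; exists 0%N => s sx.
  have inOx : inO (s ++ t s).
    apply: (proj2 (tP s)) => sO; apply: ns; exists s => //.
    exact: cyl_cat sx.
  by apply: nOx; exact: inOx sx.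
have [W WP] := Sfs phi.
pose avoid n (u : U) :=
  if unpickle n is Some s then offO s -> ~ cyl s (sval u) else True.
(* The [n]-th set avoids the [n]-th closed set given by [W] and the [n]-th exterior cylinder, both
   coarsely closed. *)
exists (fun n => [set x : X |
  (exists2 s, W n s & cyl s (enc (sval x))) /\ avoid n x]).
  move=> n; apply/prefix_openE => x [[s Ws sx] ox].
  have [L LP] : exists L, forall y : U, agree L (enc (sval x)) (enc (sval y)) ->
      avoid n y.
    move: ox; rewrite /avoid; case: unpickle => [s'|_]; last by exists 0%N.
    have [sO|sO] := pselect (offO s'); last by move=> _; exists 0%N.
    by move=> /(_ sO)/cyl_closed[L LP]; exists L => y xy _; exact: LP.
  exists (maxn L (size s)) => y xy; split.
    exists s => //; apply: cyl_agree sx _; apply: agree_le xy.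
    exact: leq_maxr.
  by apply: LP; apply: agree_le xy; exact: leq_maxl.
apply/seteqP; split=> [x Ox n _|x xF] /=.
  split.
    apply: contrapT => xn; apply: (phiO x Ox); apply/(WP _ (svalP x)).
    by exists n => s Ws sx; apply: xn; exists s.
  by rewrite /avoid; case: unpickle => // s sO sx; exact: (sO x).
apply: contrapT => nOx; have [|s sO sx] := phiN x nOx.
  move=> /(WP _ (svalP x))[n xn].
  by have [[s /xn]] := xF n Logic.I.
by have [_] := xF (pickle s) Logic.I; rewrite /avoid pickleK => /(_ sO).
Qed.

(* On a closed set dense in a cylinder [cyl s] of the fine topology, a
   continuous [f] would preserve the value [0] at coordinate [size s], which is
   a limit of nonzero values in the coarse topology. *)
Lemma id_not_piecewise_continuous : ~ piecewise_continuous f.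
Proof.
move=> [CC [/countable_injP[h hI] CCclosed CCcover CCcont]].
have hI' C D : CC C -> CC D -> h C = h D -> C = D.
  by move=> CC1 CC2; apply: hI; exact: mem_set.
have [[C CCC [s Cs]]|nC] := pselect (exists2 C, CC C & exists s, forall t,
    exists2 u : U, C u & cyl (s ++ t) (sval u)); last first.
  (* Otherwise every piece is finely nowhere dense, and the numbering [h] turns the cover into a
     meager set containing [S], contrary to [Snm]. *)
  have /choice[phi phiP] (ns : nat * seq nat) : exists t, forall C, CC C ->
      h C = ns.1 -> forall u : U, C u -> ~ cyl (ns.2 ++ t) (sval u).
    have [[C [CCC hC]]|nh] := pselect (exists C, CC C /\ h C = ns.1);
      last first.
      by exists [::] => C CCC hC; case: nh; exists C.
    have [t tP] : exists t, forall u : U, C u -> ~ cyl (ns.2 ++ t) (sval u).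
      apply: contrapT => nt; apply: nC; exists C => //; exists ns.2 => t.
      apply: contrapT => nu; apply: nt; exists t => u Cu su.
      by apply: nu; exists u.
    by exists t => D CCD hD; rewrite (hI' D C CCD CCC) ?hC ?hD.
  have [x [Sx _ nx]] := Snm [::] (fun n s => phi (n, s)).
  have : [set: X] (exist _ x Sx) by [].
  rewrite -CCcover => -[C CCC Cx].
  by apply: nx; exists (h C) => s; exact: (phiP (h C, s) C CCC erefl _ Cx).
(* Coarsely closed sets are finely closed, so density in the trace of [s] gives all of it. *)
have sC (u : U) : cyl s (sval u) -> C u.
  move=> su; apply: contrapT => nCu.
  have [|m mC] := @open_enc (~` C) _ u nCu.
    by rewrite openC; exact: CCclosed.
  have [t st] := cyl_extend m su; have [v Cv sv] := Cs t.
  by apply: (mC v) => //; apply: agree_sym; exact: st.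
have [x sx] := Sdense (rcons s 0%N).
have xs : sval x (size s) = 0%N.
  by rewrite sx ?size_rcons// nth_rcons ltnn eqxx.
have x_s : cyl s (sval x) by move: sx; rewrite -cats1; exact: cyl_cat.
have /subspace_continuousP/(_ x (sC x x_s)) := CCcont C CCC.
have Oo : open ([set y | sval y (size s) = 0%N] : set Y).
  by apply/prefix_openE => y y0; exists (size s).+1 => z yz; rewrite /= -yz.
move=> /(_ [set y | sval y (size s) = 0%N]) [].
  by exists [set y | sval y (size s) = 0%N]; split.
move=> B [/prefix_openE oB Bx Bf].
have [L LB] := oB x Bx.
have [v vP] := enc_bound L.
(* Coordinates of [enc] below [L] test only for values up to [v], so they cannot tell [v.+1] at
   coordinate [size s] from the value [0] of [x]. *)
pose t := mkseq (fun j => if j == size s then v.+1 else sval x j)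
  (maxn v (size s)).+1.
have [y ty] := Sdense t.
have yE j : (j <= maxn v (size s))%N ->
    sval y j = if j == size s then v.+1 else sval x j.
  by move=> jv; rewrite ty ?size_mkseq// nth_mkseq.
have y_s : cyl s (sval y).
  move=> j js; rewrite yE; last by rewrite leq_max (ltnW js) orbT.
  by rewrite (ltn_eqF js) x_s.
have := Bf y (LB y _) (sC y y_s).
rewrite /f /= yE ?eqxx; last by rewrite leq_maxr.
move=> H; suff : v.+1 = 0%N by [].
apply: H => j jL; rewrite /enc; case jp : unpickle => [[n k]|//] /=.
have [/= nv kv] := vP j _ jL jp.
rewrite yE; last by rewrite leq_max (ltnW nv).
have [->|//] := eqVneq n (size s); rewrite xs /= eqSS.
by case: eqP => // vk; rewrite -vk ltnn in kv.
Qed.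

End LuzinSet.

Theorem mainTheorem2 (R : realType) (MA : MartinAxiom) :
  exists X Y : topologicalType,
    [/\ separable X, metrizable R X, separable Y, metrizable R Y &
      exists f : X -> Y,
        Gdelta_measurable_map f /\ ~ piecewise_continuous f].
Proof.
have [S [Snm Sfs]] := exists_Luzin_set MA.
have [x [Sx _ _]] := Snm [::] (fun _ _ => [::]).
pose u0 : {x | S x} := exist _ x Sx.
have sval_inj : injective (fun u : {x | S x} => sval u : baire).
  by move=> [y Sy] [z Sz] /= yz; exact: eq_exist.
exists (prefix_space (fun u : {x | S x} => enc (sval u))).
exists (prefix_space (fun u : {x | S x} => sval u)); split.
- exact: prefix_separable u0.
- by apply: prefix_metrizable => u v /enc_inj/sval_inj.
- exact: prefix_separable u0.
- exact: prefix_metrizable.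
exists (fun u => u); split.
  exact: id_Gdelta_measurable.
exact: id_not_piecewise_continuous.
Qed.
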